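(* Let $X$ be a complex Banach space, $T\in B(X)$, and $N\ge1$ an integer. Let $\mathcal{X}_{N+1}=\bigoplus_{k=0}^N X$ be equipped with the norm $\|x_0\oplus\dots\oplus x_N\|:=\big(\sum_{j=0}^N\|x_j\|^2\big)^{1/2}$, and let $\mathcal{T}_{N+1}\in B(\mathcal{X}_{N+1})$ be the operator given by the $(N+1)\times(N+1)$ lower bidiagonal operator matrix $$\mathcal{T}_{N+1}=\begin{pmatrix} T&0&0&\cdots&0\\ I-T&T&0&\cdots&0\\ 0&I-T&T&\cdots&0\\ \vdots&\vdots&\ddots&\ddots&\vdots\\ 0&0&\cdots&I-T&T\end{pmatrix}.$$ Then: (1) $T$ is power bounded if and only if $\mathcal{T}_{N+1}$ is Cesàro-$N$ bounded. (2) $(T^n)_{n\in\mathbb{N}}$ converges in the strong operator topology of $X$ if and only if the sequence $\big(n^{-N}S_n^N(\mathcal{T}_{N+1})\big)_{n\in\mathbb{N}}$ converges in the strong operator topology of $\mathcal{X}_{N+1}$.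
   Context: $\mathbb{N}=\{1,2,\dots\}$. An operator $S$ is power bounded if $\sup_{n\ge0}\|S^n\|<\infty$. For $\gamma>0$, $S_n^{\gamma}(S):=\sum_{j=0}^n A_{n-j}^{\gamma-1}S^j$, where $A_n^{\delta}$ is defined by $(1-z)^{-(\delta+1)}=\sum_{n=0}^\infty A_n^{\delta}z^n$, $|z|<1$ (so $A_n^{\delta}=\binom{n+\delta}{n}$). $S$ is Cesàro-$\gamma$ bounded if $\|S_n^{\gamma}(S)\|=O(n^{\gamma})$, i.e. there is $C>0$ with $\|S_n^\gamma(S)\|\le Cn^\gamma$ for all $n\ge1$. *)

(* Defs.v *)
(* Complex spaces are modules over R[i], for an arbitrary R : realType. *)
From HB Require Import structures.
From mathcomp Require Import all_boot all_order all_algebra.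
From mathcomp Require Import all_classical all_reals all_analysis.
From mathcomp Require Import complex ring lra.
Set Implicit Arguments.
Unset Strict Implicit.
Unset Printing Implicit Defensive.
Import Order.TTheory GRing.Theory Num.Theory.
Import numFieldNormedType.Exports.
Local Open Scope classical_set_scope.
Local Open Scope ring_scope.
Local Open Scope complex_scope.

Lemma cvg_sum_ord {C : numFieldType} {V : normedModType C} {I : Type}
    {F : set_system I} {FF : Filter F} n (f : 'I_n -> I -> V) (l : 'I_n -> V) :
  (forall i, f i t @[t --> F] --> l i) ->
  \sum_(i < n) f i t @[t --> F] --> \sum_(i < n) l i.
Proof.
move=> fl; have add := @add_continuous V.
exact: (@cvg_big V 'I_n _ 0 xpredT add I F _ f l FF (fun i _ => fl i)).
Qed.

Definition l2sum (C : numClosedFieldType) (X : normedModType C) (n : nat) :=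
  {ffun 'I_n -> X}.

HB.instance Definition _ (C : numClosedFieldType) (X : normedModType C) n :=
  GRing.Lmodule.on (l2sum X n).

Section l2norm.
Context {C : numClosedFieldType} {X : normedModType C} {n : nat}.
Implicit Types (x y : l2sum X n) (a b : 'I_n -> C).

Definition l2norm x : C := sqrtC (\sum_(i < n) `|x i| ^+ 2).

Lemma sum_sqr_norm_ge0 x : 0 <= \sum_(i < n) `|x i| ^+ 2.
Proof. by apply: sumr_ge0 => i _; exact: exprn_ge0. Qed.

Lemma l2norm_ge0 x : 0 <= l2norm x.
Proof. by rewrite sqrtC_ge0 sum_sqr_norm_ge0. Qed.

Lemma cauchy_schwarz_sum a b : (forall i, 0 <= a i) -> (forall i, 0 <= b i) ->
  (\sum_i a i * b i) ^+ 2 <= (\sum_i a i ^+ 2) * (\sum_i b i ^+ 2).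
Proof.
move=> a0 b0; rewrite -subr_ge0 -(pmulrn_lge0 _ (ltn0Sn 1)).
suff -> : ((\sum_i a i ^+ 2) * (\sum_i b i ^+ 2) - (\sum_i a i * b i) ^+ 2) *+ 2
    = \sum_i \sum_j (a i * b j - a j * b i) ^+ 2.
  apply: sumr_ge0 => i _; apply: sumr_ge0 => j _.
  by apply: real_exprn_even_ge0 => //; rewrite rpredB// realM// ger0_real.
transitivity (\sum_i \sum_j (a i ^+ 2 * b j ^+ 2)
   + \sum_i \sum_j (a j ^+ 2 * b i ^+ 2)
   - (\sum_i \sum_j ((a i * b i) * (a j * b j))) *+ 2).
  rewrite [X in _ + X - _]exchange_big/= -mulr2n -mulrnBl expr2.
  by rewrite !mulr_suml; congr ((_ - _) *+ _);
     apply: eq_bigr => i _; rewrite mulr_sumr.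
rewrite -sumrMnl -big_split -sumrB; apply: eq_bigr => i _.
rewrite -sumrMnl -big_split -sumrB; apply: eq_bigr => j _ /=.
ring.
Qed.

Lemma ler_l2normD x y : l2norm (x + y) <= l2norm x + l2norm y.
Proof.
rewrite -(@ler_pXn2r _ 2)// ?nnegrE ?addr_ge0 ?l2norm_ge0//.
rewrite sqrrD !sqrtCK.
apply: (@le_trans _ _ (\sum_(i < n) (`|x i| + `|y i|) ^+ 2)).
  by apply: ler_sum => i _; rewrite lerXn2r ?nnegrE ?addr_ge0// ffunE ler_normD.
under eq_bigr do rewrite sqrrD.
rewrite !big_split/= lerD2r lerD2l -mulr2n lerMn2r/=.
rewrite -(@ler_pXn2r _ 2)// ?nnegrE ?mulr_ge0 ?l2norm_ge0//; last first.
  by apply: sumr_ge0 => i _; exact: mulr_ge0.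
by rewrite exprMn !sqrtCK cauchy_schwarz_sum.
Qed.

Lemma l2normZ (l : C) x : l2norm (l *: x) = `|l| * l2norm x.
Proof.
rewrite /l2norm (eq_bigr (fun i => `|l| ^+ 2 * `|x i| ^+ 2)); last first.
  by move=> i _; rewrite ffunE normrZ exprMn.
rewrite -mulr_sumr sqrtCM ?nnegrE ?sum_sqr_norm_ge0 ?exprn_ge0//.
by rewrite sqrCK.
Qed.

Lemma l2norm_eq0 x : l2norm x = 0 -> x = 0.
Proof.
move=> /eqP; rewrite sqrtC_eq0 psumr_eq0; last by move=> i _; exact: exprn_ge0.
move=> /allP x0; apply/ffunP => i; rewrite ffunE; apply/eqP.
by have := x0 i (mem_index_enum i); rewrite /= expf_eq0/= normr_eq0.
Qed.

End l2norm.

HB.instance Definition _ (C : numClosedFieldType) (X : normedModType C) n :=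
  Lmodule_isNormed.Build C (l2sum X n) (@ler_l2normD C X n)
    (@l2normZ C X n) (@l2norm_eq0 C X n).

Section l2sum_theory.
Context {C : numClosedFieldType} {X : normedModType C} {n : nat}.
Implicit Types x y : l2sum X n.

Lemma l2sum_normE x : `|x| = sqrtC (\sum_(i < n) `|x i| ^+ 2).
Proof. by []. Qed.

Lemma l2sum_coord_le x i : `|x i| <= `|x|.
Proof.
rewrite -(@ler_pXn2r _ 2)// ?nnegrE// l2sum_normE sqrtCK (bigD1 i)//= lerDl.
by apply: sumr_ge0 => j _; exact: exprn_ge0.
Qed.

Lemma l2sum_norm_le_sum x : `|x| <= \sum_(i < n) `|x i|.
Proof.
have s0 (P : pred 'I_n) : 0 <= \sum_(i < n | P i) `|x i| by exact: sumr_ge0.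
rewrite -(@ler_pXn2r _ 2)// ?nnegrE// l2sum_normE sqrtCK expr2 mulr_suml.
apply: ler_sum => i _; rewrite expr2 ler_wpM2l// (bigD1 i)//= lerDl.
exact: s0.
Qed.

Lemma l2sum_cvgP {I : Type} {F : set_system I} {FF : Filter F}
    (f : I -> l2sum X n) (l : l2sum X n) :
  f @ F --> l <-> forall i, f t i @[t --> F] --> l i.
Proof.
split=> [fl i|fl].
  apply/cvgrPdist_lt => e e0; near=> t.
  have -> : l i - f t i = (l - f t) i by rewrite !ffunE.
  apply: le_lt_trans (l2sum_coord_le _ _) _.
  by near: t; exact: cvgr_dist_lt.
have d0 t : 0 <= \sum_(i < n) `|l i - f t i| by apply: sumr_ge0.
have s0 := @cvg_sum_ord C C^o _ F FF n (fun i t => `|l i - f t i|)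
  (fun i => `|l i - l i|) (fun i => cvg_norm (cvgB (cvg_cst (l i)) (fl i))).
rewrite big1 in s0; last by move=> i _; rewrite subrr normr0.
move/(_ FF FF FF)/cvgrPdist_lt in s0.
apply/cvgrPdist_lt => e e0; near=> t.
apply: le_lt_trans (l2sum_norm_le_sum _) _.
rewrite (eq_bigr (fun i => `|l i - f t i|)); last by move=> i _; rewrite !ffunE.
rewrite -[ltLHS]ger0_norm // -normrN -sub0r.
by near: t; exact: s0.
Unshelve. all: by end_near. Qed.

End l2sum_theory.

Section l2sum_complete.
Context {C : numClosedFieldType} {X : completeNormedModType C} {n : nat}.

Lemma l2sum_complete (F : set_system (l2sum X n)) :
  ProperFilter F -> cauchy F -> cvg F.
Proof.
move=> FF /cauchyP Fc.
have cvgi (i : 'I_n) : cvg ((fun x : l2sum X n => x i) @ F).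
  apply/cauchy_cvgP/cauchyP => e e0.
  have [x Fx] := Fc _ e0; exists (x i).
  suff s : ball x e `<=` (fun y : l2sum X n => y i) @^-1` ball (x i) e.
    exact: (@filterS _ F _ _ _ s Fx).
  move=> y; rewrite /preimage/= -!ball_normE /=; apply: le_lt_trans.
  by have := l2sum_coord_le (x - y) i; rewrite !ffunE.
apply/cvg_ex; exists [ffun i => lim ((fun x : l2sum X n => x i) @ F)].
have FF' : Filter F by exact: filter_filter.
apply: ((@l2sum_cvgP _ _ _ _ F FF' id _).2) => i; rewrite ffunE.
exact: cvgi.
Qed.

End l2sum_complete.

HB.instance Definition _ (C : numClosedFieldType) (X : completeNormedModType C)
    n :=
  Uniform_isComplete.Build (l2sum X n) (@l2sum_complete C X n).

Section operators.
Context {R : realType} {X : normedModType R[i]}.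
Implicit Types (S T : X -> X) (F : nat -> X -> X).

(* The norm of a space over R[i] is R[i]-valued; [complex.Re] recovers the real
   number. *)
Definition opnorm S : \bar R :=
  ereal_sup [set (complex.Re `|S x|)%:E | x in [set x | `|x| <= 1]].

Definition power_bounded S : Prop :=
  (ereal_sup [set opnorm (iter n S) | n in [set: nat]] < +oo)%E.

(* The limit is required to be a bounded operator. *)
Definition sot_cvg F : Prop :=
  exists L : {linear X -> X},
    continuous L /\ forall x, F n x @[n --> \oo] --> L x.

End operators.

(* A_n^d = binom(n + d, n), the n-th coefficient of (1 - z)^(-(d + 1)): see
   [cesaro_num_genfun]. *)
Definition cesaro_num {R : realType} (d : R) (n : nat) : R :=
  \prod_(1 <= i < n.+1) ((d + i%:R) / i%:R).

Section genfun.
Context {R : realType}.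
Implicit Types (d z : R).

Lemma cesaro_num0 d : cesaro_num d 0 = 1.
Proof. by rewrite /cesaro_num big_geq. Qed.

Lemma cesaro_numS d n :
  n.+1%:R * cesaro_num d n.+1 = (d + n.+1%:R) * cesaro_num d n.
Proof.
rewrite /cesaro_num big_nat_recr//= mulrC -mulrA divfK ?pnatr_eq0//.
by rewrite mulrC.
Qed.

Lemma cesaro_num_shift d n :
  n.+1%:R * cesaro_num d n.+1 = (d + 1) * cesaro_num (d + 1) n.
Proof.
elim: n => [|n ih]; first by rewrite cesaro_numS !cesaro_num0 !mulr1.
apply: (@mulfI _ n.+1%:R); first by rewrite pnatr_eq0.
rewrite [in LHS]cesaro_numS mulrCA ih [RHS]mulrCA cesaro_numS.
by rewrite [n.+2%:R]mulrS; ring.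
Qed.

Lemma cesaro_num_pascal d n :
  cesaro_num (d + 1) n.+1 = cesaro_num d n.+1 + cesaro_num (d + 1) n.
Proof.
apply: (@mulfI _ n.+1%:R); first by rewrite pnatr_eq0.
by rewrite mulrDr [in RHS]cesaro_num_shift cesaro_numS; ring.
Qed.

Lemma cesaro_num_nat_ge0 (m n : nat) : 0 <= cesaro_num (m%:R : R) n.
Proof.
by rewrite /cesaro_num; apply: prodr_ge0 => i _; rewrite divr_ge0 ?addr_ge0.
Qed.

Lemma cesaro_num_le d (m n : nat) : `|d| <= m%:R ->
  `|cesaro_num d n| <= cesaro_num m%:R n.
Proof.
move=> dm; rewrite /cesaro_num normr_prod; apply: ler_prod => i _.
rewrite normr_ge0/= normrM normfV (@ger0_norm _ i%:R)// ler_wpM2r ?invr_ge0//.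
by rewrite (le_trans (ler_normD _ _))// lerD// ger0_norm.
Qed.

Lemma geometric_pascal d z n :
  (1 - z) * \sum_(0 <= k < n.+1) cesaro_num (d + 1) k * z ^+ k =
  \sum_(0 <= k < n.+1) cesaro_num d k * z ^+ k
  - cesaro_num (d + 1) n * z ^+ n.+1.
Proof.
elim: n => [|n ih]; first by rewrite !big_nat1 !cesaro_num0 !expr0; ring.
rewrite big_nat_recr//= mulrDr ih [in RHS]big_nat_recr//= cesaro_num_pascal.
by rewrite !exprS; ring.
Qed.

Lemma cesaro_num_zero n : cesaro_num (0 : R) n = 1.
Proof.
elim: n => [|n ih]; first exact: cesaro_num0.
by apply: (@mulfI _ n.+1%:R); rewrite ?pnatr_eq0// cesaro_numS ih add0r.
Qed.

Lemma is_cvg_cesaro_nat (m : nat) z : 0 <= z -> z < 1 ->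
  cvgn (pseries (cesaro_num m%:R) z).
Proof.
move=> z0 z1.
have t0 (k l : nat) : 0 <= cesaro_num (k%:R : R) l * z ^+ l.
  by rewrite mulr_ge0 ?exprn_ge0 ?cesaro_num_nat_ge0.
have nd (k : nat) : nondecreasing_seq (pseries (cesaro_num k%:R) z).
  by apply: nondecreasing_series => i _ _; exact: t0.
suff : exists M, forall n, pseries (cesaro_num m%:R) z n <= M.
  by move=> [M hM]; apply: nondecreasing_is_cvgn => //; exists M => _ [n _ <-].
elim: m => [|m [M hM]].
  exists (1 / (1 - z)) => n; rewrite ler_pdivlMr ?subr_gt0// mulrC.
  have -> : pseries (cesaro_num 0%:R) z n = \sum_(0 <= k < n) z ^+ k.
    apply: eq_bigr => k _. by rewrite /= cesaro_num_zero mul1r.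
  rewrite big_mkord -opprB mulNr -subrX1 opprB lerBlDr lerDl exprn_ge0//.
exists (M / (1 - z)) => n; rewrite ler_pdivlMr ?subr_gt0// mulrC.
apply: le_trans (_ : (1 - z) * pseries (cesaro_num m.+1%:R) z n.+1 <= M).
  apply: ler_wpM2l; first by rewrite subr_ge0 ltW.
  exact: (nd m.+1 n n.+1 (leqnSn n)).
rewrite /pseries /series/= -natr1 geometric_pascal.
apply: le_trans (hM n.+1).
rewrite lerBlDr lerDl mulr_ge0 ?exprn_ge0//.
by have := cesaro_num_nat_ge0 m.+1 n; rewrite -natr1.
Qed.

Lemma is_cvg_cesaro d z : `|z| < 1 -> cvgn (pseries (cesaro_num d) z).
Proof.
move=> z1; apply: normed_cvg; rewrite /normed_series_of/=.
have [m dm] : exists m : nat, `|d| <= m%:R.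
  by by exists (Num.truncn `|d|).+1; apply: ltW; exact: truncnS_gt.
apply: (@series_le_cvg _ _ (fun n => cesaro_num m%:R n * `|z| ^+ n)).
- by [].
- by move=> n; rewrite mulr_ge0 ?exprn_ge0 ?cesaro_num_nat_ge0.
- by move=> n; rewrite normrM normrX ler_wpM2r ?exprn_ge0// cesaro_num_le.
- by apply: is_cvg_cesaro_nat.
Qed.

Lemma pseries_diffs_cesaro d :
  pseries_diffs (cesaro_num d) = (d + 1) *: (cesaro_num (d + 1) : nat -> R).
Proof. by apply/funext => n; rewrite /pseries_diffs cesaro_num_shift. Qed.

Lemma is_cvg_cesaroZ a d z : `|z| < 1 ->
  cvgn (pseries (a *: (cesaro_num d : nat -> R)) z).
Proof.
move=> z1; rewrite /pseries.
have -> : (fun i => (a *: (cesaro_num d : nat -> R)) i * z ^+ i)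
   = a *: (fun i => cesaro_num d i * z ^+ i).
  by apply/funext => i; exact/esym/mulrA.
by apply: is_cvg_seriesZ; exact: is_cvg_cesaro.
Qed.

Lemma lim_pseries_diffs_cesaro d z : `|z| < 1 ->
  limn (pseries (pseries_diffs (cesaro_num d)) z) =
  (d + 1) * limn (pseries (cesaro_num (d + 1)) z).
Proof.
move=> z1; rewrite pseries_diffs_cesaro /pseries.
have -> : (fun i => ((d + 1) *: (cesaro_num (d + 1) : nat -> R)) i * z ^+ i)
   = (d + 1) *: (fun i => cesaro_num (d + 1) i * z ^+ i).
  by apply/funext => i; exact/esym/mulrA.
by rewrite lim_seriesZ//; exact: is_cvg_cesaro.
Qed.

Lemma lim_cesaro_shift d z : `|z| < 1 ->
  (1 - z) * limn (pseries (cesaro_num (d + 1)) z) =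
  limn (pseries (cesaro_num d) z).
Proof.
move=> z1; apply/esym/cvg_lim => //.
have c1 := @is_cvg_cesaro (d + 1) z z1.
have t0 : cesaro_num (d + 1) n * z ^+ n @[n --> \oo] --> (0 : R).
  exact: cvg_series_cvg_0.
rewrite -(cvg_shiftS (pseries (cesaro_num d) z)).
have -> : (fun n => pseries (cesaro_num d) z n.+1) = (fun n =>
    (1 - z) * pseries (cesaro_num (d + 1)) z n.+1
    + z * (cesaro_num (d + 1) n * z ^+ n)).
  apply/funext => n; rewrite /pseries /series/= geometric_pascal exprS; ring.
have c1' : pseries (cesaro_num (d + 1)) z n.+1 @[n --> \oo] -->
    limn (pseries (cesaro_num (d + 1)) z).
  by rewrite (cvg_shiftS (pseries (cesaro_num (d + 1)) z)); exact: c1.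
have := cvgD (cvgMl_tmp (a := 1 - z) c1') (cvgMl_tmp (a := z) t0).
by rewrite mulr0 addr0; exact.
Qed.

Lemma is_derive_cesaro d z : `|z| < 1 ->
  is_derive z (1 : R) (fun x => limn (pseries (cesaro_num d) x))
    ((d + 1) * limn (pseries (cesaro_num (d + 1)) z)).
Proof.
move=> z1; rewrite -lim_pseries_diffs_cesaro//.
pose K : R := (`|z| + 1) / 2.
have zK : `|z| < K by rewrite /K; lra.
have K0 : 0 <= K by rewrite /K; have := normr_ge0 z; lra.
have K1 : `|K| < 1 by rewrite ger0_norm// /K; lra.
have dZ a b : pseries_diffs (a *: (cesaro_num b : nat -> R)) =
    (a * (b + 1)) *: (cesaro_num (b + 1) : nat -> R).
  apply/funext => n; rewrite /pseries_diffs !scalrfctE /GRing.scale/=.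
  by rewrite mulrCA cesaro_num_shift mulrA.
apply: (@pseries_snd_diffs _ _ K).
- exact: is_cvg_cesaro.
- by rewrite pseries_diffs_cesaro; exact: is_cvg_cesaroZ.
- by rewrite pseries_diffs_cesaro dZ; exact: is_cvg_cesaroZ.
- by rewrite (ger0_norm K0).
Qed.

Theorem cesaro_num_genfun d z : `|z| < 1 ->
  [series cesaro_num d n * z ^+ n]_n @ \oo --> (1 - z) `^ (- (d + 1)).
Proof.
move=> z1; have cz := @is_cvg_cesaro d z z1.
suff <- : limn (pseries (cesaro_num d) z) = (1 - z) `^ (- (d + 1)) by exact: cz.
pose g (x : R) := limn (pseries (cesaro_num d) x) * (1 - x) `^ (d + 1).
have dg (x : R) : `|x| < 1 -> is_derive x (1 : R) g 0.
  move=> x1; have x1' : 0 < 1 - x by move: x1; rewrite ltr_norml; lra.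
  have d1 := @is_derive_cesaro d x x1.
  have d2 : is_derive x (1 : R) (fun x : R => 1 - x) (-1).
    by rewrite -[-1]sub0r; apply: is_deriveB.
  have d3 := @is_derive1_comp R (@powR R ^~ (d + 1)) (fun x : R => 1 - x) x
    _ _ (is_derive1_powR (d + 1) x1') d2.
  have := is_deriveM d1 d3; set l := (X in is_derive _ _ _ X) => d4.
  suff <- : l = 0 by exact: d4.
  rewrite {d4}/l.
  rewrite /= -(@lim_cesaro_shift d x x1) addrK /GRing.scale/=.
  have -> : (1 - x) `^ (d + 1) = (1 - x) * (1 - x) `^ d.
    by rewrite powRD ?powRr1 ?ltW 1?mulrC// (gt_eqF x1') implybT.
  ring.
have g0 : g 0 = 1.
  rewrite /g subr0 powR1 mulr1; apply: cvg_lim => //.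
  rewrite -(cvg_shiftS (pseries (cesaro_num d) 0)).
  have -> : (fun n => pseries (cesaro_num d) 0 n.+1) = fun=> 1.
    apply/funext => n; rewrite /pseries /series/= big_nat_recl//= cesaro_num0.
    rewrite expr0 mulr1 big1 ?addr0// => i _.
    by rewrite expr0n mulr0.
  exact: cvg_cst.
have gz : g z = 1.
  have gc (a b : R) : `|a| < 1 -> `|b| < 1 -> a <= b -> g a = g b.
    move=> a1 b1 ab.
    have in1 (x : R) : a <= x -> x <= b -> `|x| < 1.
      by move: a1 b1; rewrite !ltr_norml; lra.
    have [x||c _] := @MVT_segment _ g (fun=> 0) a b ab.
    - by rewrite in_itv/= => /andP[ax xb]; apply: dg; apply: in1; exact: ltW.
    - apply: derivable_within_continuous => x; rewrite in_itv/= => /andP[ax xb].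
      by have [] := dg x (in1 x ax xb).
    - by rewrite mul0r => /eqP; rewrite subr_eq0 => /eqP.
  have [z0|/ltW z0] := leP 0 z.
    by rewrite -(gc 0 z) ?normr0.
  by rewrite (gc z 0) ?normr0.
have z0 : 0 < 1 - z by move: z1; rewrite ltr_norml; lra.
have p0 : (1 - z) `^ (d + 1) != 0 by rewrite gt_eqF ?powR_gt0.
by rewrite powRN; apply: (mulIf p0); rewrite mulVf.
Qed.
End genfun.

Section cesaro.
Context {R : realType} {X : normedModType R[i]}.

Definition cesaro_sum (gamma : R) (S : X -> X) (n : nat) : X -> X :=
  fun x => \sum_(0 <= j < n.+1)
    (cesaro_num (gamma - 1) (n - j))%:C *: iter j S x.

Definition cesaro_bounded (gamma : R) (S : X -> X) : Prop :=
  exists2 c : R, 0 < c & forall n : nat, (1 <= n)%N ->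
    (opnorm (cesaro_sum gamma S n) <= (c * n%:R `^ gamma)%:E)%E.

End cesaro.

Section bidiag.
Context {C : numClosedFieldType} {X : normedModType C}.

Definition opmatrix_apply {m n} (M : 'I_m -> 'I_n -> X -> X) (x : l2sum X n) :
    l2sum X m :=
  [ffun i => \sum_(j < n) M i j (x j)].

Definition bidiag_entry (T : X -> X) n (i j : 'I_n) : X -> X :=
  if i == j :> nat then T
  else if i == j.+1 :> nat then fun v => v - T v
  else fun=> 0.

Definition bidiag (T : X -> X) n : l2sum X n -> l2sum X n :=
  opmatrix_apply (@bidiag_entry T n).

Lemma bidiag_entry_linear (T : {linear X -> X}) n (i j : 'I_n) :
  linear (bidiag_entry T i j).
Proof.
move=> a u v; rewrite /bidiag_entry.
case: ifP => _; first by rewrite linearP.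
case: ifP => _; last by rewrite scaler0 addr0.
by rewrite linearP scalerBr opprD addrACA.
Qed.

Lemma bidiag_is_linear (T : {linear X -> X}) n : linear (@bidiag T n).
Proof.
move=> a u v; apply/ffunP => i; rewrite !ffunE scaler_sumr -big_split.
by apply: eq_bigr => j _; rewrite !ffunE bidiag_entry_linear.
Qed.

HB.instance Definition _ (T : {linear X -> X}) n :=
  GRing.isLinear.Build C (l2sum X n) (l2sum X n) *:%R (@bidiag T n)
    (@bidiag_is_linear T n).

Lemma bidiag_continuous (T : {linear X -> X}) n :
  continuous T -> continuous (@bidiag T n).
Proof.
move=> cT x.
have cM i j : continuous (@bidiag_entry T n i j).
  rewrite /bidiag_entry => v; case: ifP => _; first exact: cT.
  case: ifP => _; last exact: cvg_cst.
  by apply: cvgB; [exact: cvg_id | exact: cT].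
have cc (j : 'I_n) : (fun y : l2sum X n => y j) y @[y --> x] --> x j.
  have idx : id @ nbhs x --> x by exact: cvg_id.
  exact: (l2sum_cvgP id x).1 idx j.
apply/(@l2sum_cvgP _ _ _ _ _ (nbhs_filter x)) => i; rewrite ffunE.
under eq_fun do rewrite ffunE.
apply: (@cvg_sum_ord C X _ (nbhs x)) => j.
apply: (cvg_comp (fun y : l2sum X n => y j) _ (cc j)); exact: cM.
Qed.

End bidiag.

Arguments bidiag {C X} T n x.

(* Main.v *)
(* Work with generating functions in z. Put R = (1 - zT)^-1, S = (1 - z)^-1 and
   Phi = z(1 - T)R, so that R y is the generating function of the orbit T^n y.
   For the block operator, the coordinates Y_0, ..., Y_N of the generating
   function of its N-th Cesaro sums at x satisfy
   Y_i = S^N R x_i + Phi Y_(i-1). The identity z(1 - T) = (1 - zT) - (1 - z)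
   reads Phi S = S - R.
   - It expresses Phi^k S^a R^l R y (k <= a) through the S^(a-j) R^(l+j) R y,
     whose n-th coefficients are weighted sums of the T^m y (m <= n) with
     nonnegative weights of total mass C(n + a + l, a + l). Hence power
     boundedness, respectively strong convergence, passes to the Cesaro means;
     in the limit all terms with k > 0 cancel.
   - It also gives R = (1 - Phi)S, so R^N R y = (1 - Phi)^N S^N R y. The n-th
     coefficient of the left-hand side is C(n + N, N) T^n y, and the right-hand
     side is an alternating sum of the coordinates of the Cesaro sums at
     y + 0 + ... + 0, whence the converse. *)
Require Import Defs.
From HB Require Import structures.
From mathcomp Require Import all_boot all_order all_algebra.
From mathcomp Require Import all_classical all_reals all_analysis.
From mathcomp Require Import complex.
Import Order.TTheory GRing.Theory Num.Theory.
Import numFieldNormedType.Exports.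
Local Open Scope classical_set_scope.
Local Open Scope ring_scope.
Local Open Scope complex_scope.

(** * Power series identities for the multipliers S, R, Phi, and Cesaro sums as powers of S *)

Section series_operators.
Context {K : pzRingType} {V : lmodType K}.
Implicit Types (T : {linear V -> V}) (f g : nat -> V).

(* On generating functions, [resolvent T] is the multiplication by
   (1 - zT)^-1, so that [resolvent idfun] takes partial sums. *)
Fixpoint resolvent (T : V -> V) f n : V :=
  match n with
  | 0 => f 0
  | m.+1 => f m.+1 + T (resolvent T f m)
  end.

(* Multiplication by z(1 - T)(1 - zT)^-1. *)
Fixpoint subdiag (T : V -> V) f n : V :=
  match n with
  | 0 => 0
  | m.+1 => T (subdiag T f m) + (f m - T (f m))
  end.

Local Notation psum := (resolvent idfun).

(** [subdiag] applies 1 - T before the resolvent; as T commutes with the resolvent, the factor can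
    be pulled out. *)
Lemma subdiag_succ T f n :
  subdiag T f n.+1 = resolvent T f n - T (resolvent T f n).
Proof.
elim: n => [|n ih]; first by rewrite /= linear0 add0r.
rewrite [LHS]/= -/(subdiag T f n.+1) ih /= linearB linearD /=.
by rewrite opprD addrC addrACA.
Qed.

(* z(1 - T) = (1 - zT) - (1 - z) *)
Lemma subdiag_psum T f : subdiag T (psum f) = psum f - resolvent T f.
Proof.
apply/funext; elim=> [|n ih]; first by rewrite /= fctE subrr.
rewrite /= ih !fctE /= linearB /= opprD [RHS]addrACA subrr add0r.
by rewrite [LHS]addrC addrA subrK.
Qed.

Lemma psum_subdiag T f : psum (subdiag T f) = subdiag T (psum f).
Proof.
rewrite subdiag_psum; apply/funext; elim=> [|n ih].
  by rewrite /= !fctE subrr.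
rewrite [LHS]/= -/(subdiag T f n.+1) ih subdiag_succ !fctE /=.
by rewrite opprD [RHS]addrACA subrr add0r [LHS]addrC addrA subrK.
Qed.

(** [subdiag_succ] and [subdiag_psum] both compute coefficient n + 1 of Phi S f; equating them gives
    the induction step. *)
Lemma resolvent_psum T f : resolvent T (psum f) = psum (resolvent T f).
Proof.
apply/funext; elim=> [//|n ih].
have := subdiag_succ T (psum f) n; rewrite subdiag_psum ih !fctE /=.
rewrite opprD addrACA subrr add0r => /(canRL (subrK _)) e.
by rewrite -!addrA ih; congr (_ + _); rewrite e [RHS]addrC [LHS]addrAC subrK.
Qed.

Lemma resolventB T f g : resolvent T (f - g) = resolvent T f - resolvent T g.
Proof.
apply/funext; elim=> [//|n ih] /=.
by rewrite ih !fctE linearB opprD addrACA.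
Qed.

Lemma subdiagB T f g : subdiag T (f - g) = subdiag T f - subdiag T g.
Proof.
apply/funext; elim=> [|n ih] /=; first by rewrite !fctE subrr.
rewrite ih !fctE !(linearB T) !opprD [RHS]addrACA; congr (_ + _).
by rewrite [LHS]addrACA.
Qed.

(** The orbit is itself R y, so this is the expansion of (1 - zT)^-(l+1), built up by Pascal's
    rule. *)
Lemma iter_resolvent_orbit T l y n :
  iter l (resolvent T) (fun m => iter m T y) n = iter n T y *+ 'C(n + l, l).
Proof.
elim: l n => [n|l ih]; first by rewrite bin0 mulr1n.
elim=> [|n ihn]; first by rewrite /= -/(iter l _ _ 0) ih !binn.
rewrite iterS [LHS]/= -iterS ihn ih linearMn.
by rewrite -mulrnDr [in RHS]addnS [in RHS]binS [in RHS]addnC addSnnS.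
Qed.

Lemma iter_psum_resolvent T a f :
  iter a psum (resolvent T f) = resolvent T (iter a psum f).
Proof. by elim: a => //= a ->; rewrite resolvent_psum. Qed.

Lemma iter_psum_subdiag T a f :
  iter a psum (subdiag T f) = subdiag T (iter a psum f).
Proof. by elim: a => //= a ->; rewrite psum_subdiag. Qed.

Lemma iter_subdiagB T k f g :
  iter k (subdiag T) (f - g) = iter k (subdiag T) f - iter k (subdiag T) g.
Proof. by elim: k => //= k ->; rewrite subdiagB. Qed.

Lemma iter_psumB a f g :
  iter a psum (f - g) = iter a psum f - iter a psum g.
Proof. by elim: a => //= k ->; rewrite (resolventB idfun). Qed.

Lemma iter_psumD a f g :
  iter a psum (f + g) = iter a psum f + iter a psum g.
Proof. by apply: (canRL (subrK _)); rewrite -iter_psumB addrK. Qed.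

Lemma iter_subdiagD T k f g :
  iter k (subdiag T) (f + g) = iter k (subdiag T) f + iter k (subdiag T) g.
Proof. by apply: (canRL (subrK _)); rewrite -iter_subdiagB addrK. Qed.

(** Phi S = S - R under further factors: one Phi is removed while the number of factors S and R
    together is kept. All estimates below recurse on this. *)
Lemma iter_subdiag_psum T k a f :
  iter k.+1 (subdiag T) (iter a.+1 psum f) =
  iter k (subdiag T) (iter a.+1 psum f)
  - iter k (subdiag T) (iter a psum (resolvent T f)).
Proof.
by rewrite iterSr iterS subdiag_psum iter_subdiagB -iter_psum_resolvent.
Qed.

(** A difference of order k + 1 is the difference of order k of the first differences. *)
Lemma alternating_binomial_pascal k (u : nat -> V) :
  \sum_(l < k.+2) (-1) ^+ l *: (u l *+ 'C(k.+1, l)) =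
  \sum_(l < k.+1) (-1) ^+ l *: ((u l - u l.+1) *+ 'C(k, l)).
Proof.
have ext : \sum_(l < k.+1) (-1) ^+ l *: (u l *+ 'C(k, l)) =
    \sum_(l < k.+2) (-1) ^+ l *: (u l *+ 'C(k, l)).
  by rewrite [RHS]big_ord_recr /= bin_small// mulr0n scaler0 addr0.
under [RHS]eq_bigr do rewrite mulrnBl scalerBr.
rewrite sumrB ext [in LHS]big_ord_recl [X in _ = X - _]big_ord_recl /= !bin0
  -addrA -sumrB; congr (_ + _).
apply: eq_bigr => l _; rewrite /bump /= !add1n.
by rewrite binS mulrnDr scalerDr exprS mulN1r !scaleNr.
Qed.

(** Binomial expansion of R^k = (1 - Phi)^k S^k. In the induction, the first differences of Phi^l
    S^(k+1) f in l are Phi^l S^k R f. *)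
Lemma iter_resolventE T k f n :
  iter k (resolvent T) f n =
  \sum_(l < k.+1) (-1) ^+ l *:
    (iter l (subdiag T) (iter k psum f) n *+ 'C(k, l)).
Proof.
elim: k f => [f|k ih f].
  by rewrite big_ord_recl big_ord0 addr0 bin0 mulr1n expr0 scale1r.
rewrite iterSr ih.
rewrite (alternating_binomial_pascal k
  (fun l => iter l (subdiag T) (iter k.+1 psum f) n)).
by apply: eq_bigr => l _; rewrite iter_subdiag_psum !fctE subKr.
Qed.

End series_operators.

(** S^(m+1) = (1 - z)^-(m+1) has the coefficients A^m; each further partial sum raises the order of
    the weights by Pascal's rule. *)
Lemma iter_psum_cesaro {R : realType} {V : lmodType R[i]} (m n : nat)
    (f : nat -> V) :
  iter m.+1 (resolvent idfun) f n =
  \sum_(0 <= j < n.+1) (cesaro_num (m%:R : R) (n - j))%:C *: f j.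
Proof.
elim: m n => [|m ihm] n.
  under eq_bigr do rewrite cesaro_num_zero scale1r.
  by elim: n => [|n ih] /=; rewrite ?big_nat1// big_nat_recr//= -ih addrC.
have S g k : resolvent idfun g k.+1 = g k.+1 + resolvent idfun g k :> V by [].
rewrite iterS; elim: n => [|n ihn].
  by rewrite -[LHS]/(iter m.+1 _ f 0) ihm !big_nat1 subnn !cesaro_num0.
rewrite S ihn ihm [X in X + _]big_nat_recr//= [RHS]big_nat_recr//=.
rewrite !subnn !cesaro_num0 addrAC -big_split /=; congr (_ + _).
apply: eq_big_nat => j /andP[_ jn].
by rewrite subSn// -scalerDl -rmorphD/= -natr1 cesaro_num_pascal.
Qed.

Lemma cesaro_sumE {R : realType} {X : normedModType R[i]} (m n : nat)
    (S : X -> X) (x : X) :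
  cesaro_sum (m.+1%:R : R) S n x =
  iter m.+1 (resolvent idfun) (fun j => iter j S x) n.
Proof. by rewrite iter_psum_cesaro /cesaro_sum -natr1 addrK. Qed.

(** * Orbits of the block operator, coordinate by coordinate *)

Section bidiag_orbit.
Context {C : numClosedFieldType} {X : normedModType C} (T : {linear X -> X}).
Context (N : nat).
Implicit Types (x : l2sum X N.+1) (y : X).

Local Notation psum := (resolvent idfun).

Lemma bidiag_coord0 x : bidiag T N.+1 x ord0 = T (x ord0).
Proof.
rewrite ffunE (bigD1 ord0)//= /bidiag_entry /= big1 ?addr0// => j j0.
by rewrite ifF//; apply/negbTE; rewrite eq_sym.
Qed.

Lemma bidiag_coordS x i : (i < N)%N ->
  bidiag T N.+1 x (inord i.+1) =
  T (x (inord i.+1)) + (x (inord i) - T (x (inord i))).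
Proof.
move=> iN; have iN1 : (i < N.+1)%N by exact: ltnW.
rewrite ffunE (bigD1 (inord i.+1))//= (bigD1 (inord i))/=; last first.
  by rewrite -val_eqE /= !inordK// neq_ltn ltnSn.
rewrite /bidiag_entry !inordK// !eqxx gtn_eqF// big1 ?addr0// => j /andP[j1 j2].
move: j1 j2; rewrite -!val_eqE /= !inordK// => j1 j2.
by rewrite eqSS [i.+1 == _]eq_sym [i == _]eq_sym (negbTE j1) (negbTE j2).
Qed.

(** Row i + 1 of the matrix is the recursion defining [subdiag], driven by coordinate i; the initial
    value adds the free orbit of coordinate i + 1. *)
Lemma bidiag_orbitS x i : (i < N)%N ->
  (fun n => iter n (bidiag T N.+1) x (inord i.+1)) =
  (fun n => iter n T (x (inord i.+1)))
  + subdiag T (fun n => iter n (bidiag T N.+1) x (inord i)).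
Proof.
move=> iN; apply/funext; elim=> [|n ih]; first by rewrite fctE /= addr0.
by rewrite /= bidiag_coordS// ih !fctE linearD -addrA.
Qed.

Lemma bidiag_orbit0 x :
  (fun n => iter n (bidiag T N.+1) x ord0) = (fun n => iter n T (x ord0)).
Proof. by apply/funext; elim=> [//|n ih]; rewrite /= bidiag_coord0 ih. Qed.

Lemma iter_psum_coord a (f : nat -> l2sum X N.+1) n i :
  iter a psum f n i = iter a psum (fun m => f m i) n.
Proof.
elim: a f n => [//|a ih] f n; rewrite !iterS.
have <- : (fun m => iter a psum f m i) = iter a psum (fun m => f m i).
  exact/funext.
by elim: n => [//|n ihn] /=; rewrite ffunE ihn.
Qed.

End bidiag_orbit.

(** * Cesaro sums of order [N.+1] of the block operator with [N.+2] blocks *)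

Section bidiag_cesaro.
Context {R : realType} {X : normedModType R[i]} (T : {linear X -> X}).
Context (N : nat).
Implicit Types (x : l2sum X N.+2) (y : X).

Local Notation psum := (resolvent idfun).
Local Notation orbit y := (fun n => iter n T y).
Local Notation coord x i :=
  (fun n => cesaro_sum (N.+1%:R : R) (bidiag T N.+2) n x (inord i)).

Lemma cesaro_bidiag_coord x i :
  coord x i =
  iter N.+1 psum (fun n => iter n (bidiag T N.+2) x (inord i)).
Proof. by apply/funext => n; rewrite cesaro_sumE iter_psum_coord. Qed.

Lemma cesaro_bidiag_coord0 x : coord x 0 = iter N.+1 psum (orbit (x ord0)).
Proof.
rewrite cesaro_bidiag_coord.
have -> : inord 0 = ord0 :> 'I_N.+2 by apply/val_inj; rewrite /= inordK.
by rewrite bidiag_orbit0.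
Qed.

Lemma cesaro_bidiag_coordS x i : (i < N.+1)%N ->
  coord x i.+1 =
  iter N.+1 psum (orbit (x (inord i.+1))) + subdiag T (coord x i).
Proof.
move=> iN; rewrite !cesaro_bidiag_coord bidiag_orbitS// iter_psumD.
by rewrite iter_psum_subdiag.
Qed.

Definition l2sum_inj0 y : l2sum X N.+2 :=
  [ffun i => if i == ord0 then y else 0].

Lemma l2sum_inj0_is_linear : linear l2sum_inj0.
Proof.
move=> a u v; apply/ffunP => i; rewrite !ffunE.
by case: ifP => // _; rewrite scaler0 addr0.
Qed.

Lemma norm_l2sum_inj0 y : `|l2sum_inj0 y| <= `|y|.
Proof.
apply: le_trans (l2sum_norm_le_sum _) _.
rewrite (bigD1 ord0)//= ffunE eqxx big1 ?addr0// => i i0.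
by rewrite ffunE (negbTE i0) normr0.
Qed.

Lemma cesaro_bidiag_inj0 y i : (i < N.+2)%N ->
  coord (l2sum_inj0 y) i = iter i (subdiag T) (iter N.+1 psum (orbit y)).
Proof.
elim: i => [_|i ih iN]; first by rewrite cesaro_bidiag_coord0 ffunE eqxx.
rewrite cesaro_bidiag_coordS// ih ?(ltnW iN)// ffunE ifF; last first.
  by rewrite -val_eqE /= inordK.
suff -> : iter N.+1 psum (orbit (0 : X)) = 0 by rewrite add0r.
have -> : orbit (0 : X) = 0.
  by apply/funext; elim=> [//|n /= ->]; exact: linear0.
by rewrite -[X in iter _ _ X](subrr (0 : nat -> X)) iter_psumB subrr.
Qed.

(** Inversion formula behind both converse implications: on y + 0 + ... + 0 coordinate l is Phi^l
    S^(N+1) R y, and [iter_resolventE] recombines these. *)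
Lemma orbit_cesaro y n :
  iter n T y *+ 'C(n + N.+1, N.+1) =
  \sum_(l < N.+2) (-1) ^+ l *:
    (cesaro_sum (N.+1%:R : R) (bidiag T N.+2) n (l2sum_inj0 y) l
     *+ 'C(N.+1, l)).
Proof.
rewrite -iter_resolvent_orbit iter_resolventE; apply: eq_bigr => l _.
by rewrite -cesaro_bidiag_inj0// inord_val.
Qed.

End bidiag_cesaro.

(** * Bounds along a bounded orbit *)

Lemma binD_succ n l :
  'C(n.+1 + l.+1, l.+1) = ('C(n.+1 + l, l) + 'C(n + l.+1, l.+1))%N.
Proof. by rewrite addnS binS addnC addSnnS. Qed.

Section power_bounded_orbit.
Context {C : numFieldType} {X : normedModType C} (T : {linear X -> X}).

Local Notation psum := (resolvent idfun).
Local Notation orbit y := (fun n => iter n T y).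

(** By [binD_succ] the weights C(n + l + 1, l + 1) are the partial sums of the C(n + l, l), so the
    bound survives each [psum]. *)
Lemma norm_iter_psum_le (f : nat -> X) (M : C) a l n :
  (forall m, `|f m| <= M *+ 'C(m + l, l)) ->
  `|iter a psum f n| <= M *+ 'C(n + (l + a), l + a).
Proof.
elim: a l f n => [|a ih] l f n fM; first by rewrite addn0.
rewrite iterSr addnS -addSn; apply: ih => m.
elim: m => [|m ihm].
  by rewrite /=; have := fM 0; rewrite !binn.
rewrite /= binD_succ mulrnDr.
by apply: le_trans (ler_normD _ _) _; apply: lerD.
Qed.

(** Each Phi is absorbed by one S through Phi S = S - R, which requires k <= a and doubles the
    number of terms, whence 2 ^ k. The total l + a, and with it the binomial, does not change. *)
Lemma norm_iter_subdiag_le (y : X) (M : C) k a l n : 0 <= M ->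
    (forall m, `|iter m T y| <= M) -> (k <= a)%N ->
  `|iter k (subdiag T) (iter a psum (iter l (resolvent T) (orbit y))) n|
    <= M *+ 2 ^ k *+ 'C(n + (l + a), l + a).
Proof.
move=> M0 yM; elim: k a l n => [|k ih] [|a] l n // ka;
  rewrite ?expn0 ?mulr1n.
- by rewrite /= iter_resolvent_orbit addn0 normrMn lerMn2r yM orbT.
- apply: norm_iter_psum_le => m.
  by rewrite iter_resolvent_orbit normrMn lerMn2r yM orbT.
rewrite iter_subdiag_psum fctE.
apply: le_trans (ler_normB _ _) _.
rewrite expnS mul2n -addnn mulrnDr mulrnDl.
apply: lerD; first by apply: ih; exact: leqW.
by rewrite -iterS addnS -addSn; exact: ih.
Qed.

End power_bounded_orbit.

(** * Limits of binomially weighted means *)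

Lemma bin_power_cvg (C : numFieldType)
    (archi : forall z : C, 0 <= z -> exists m : nat, z <= m%:R) (N : nat) :
  (n%:R ^+ N)^-1 * 'C(n + N, N)%:R @[n --> \oo] --> ((N`!%:R)^-1 : C).
Proof.
have inv0 : (n%:R : C)^-1 @[n --> \oo] --> (0 : C).
  apply/cvgrPdist_le => e e0.
  have ei0 : 0 < e^-1 by rewrite invr_gt0.
  have [m em] := archi _ (ltW ei0).
  exists m.+1 => // n /= mn.
  have n0 : (0 : C) < n%:R by rewrite ltr0n (leq_trans _ mn).
  rewrite sub0r normrN ger0_norm ?invr_ge0 ?ler0n//.
  rewrite -[leRHS]invrK lef_pV2//.
  by apply: le_trans em _; rewrite ler_nat ltnW.
elim: N => [|N ih].
  under eq_fun do rewrite expr0 invr1 mul1r bin0.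
  by rewrite fact0 invr1; exact: cvg_cst.
(* (N+1) C(n+N+1, N+1) = (n+N+1) C(n+N, N), and for n >= 1 dividing n+N+1 by n leaves 1 +
   (N+1)/n. *)
apply: (@cvg_trans _ ((fun n => N.+1%:R^-1 * ((n%:R ^+ N)^-1 * 'C(n + N, N)%:R
    * (1 + N.+1%:R * n%:R^-1)) : C) @ \oo)).
  apply: near_eq_cvg; exists 1%N => // n /= n0.
  have nz : (n%:R : C) != 0 by rewrite pnatr_eq0 -lt0n.
  have Nz : (N.+1%:R : C) != 0 by rewrite pnatr_eq0.
  apply: (mulfI Nz); rewrite mulVKf//.
  rewrite [RHS]mulrCA -natrM -mul_bin_diag addnS natrM -addnS natrD.
  rewrite (_ : 1 + _ = n%:R^-1 * (n%:R + N.+1%:R)); last first.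
    by rewrite mulrDr mulVf// [RHS]addrC mulrC addrC.
  rewrite exprS invfM addnS /= mulrACA; congr (_ * _); exact: mulrC.
have -> : (N.+1`!%:R)^-1 = N.+1%:R^-1 * ((N`!%:R)^-1 * (1 + N.+1%:R * 0)) :> C.
  by rewrite mulr0 addr0 mulr1 factS natrM invfM.
apply: cvgMl_tmp; apply: cvgM => //.
by apply: cvgD; [exact: cvg_cst|exact: cvgMl_tmp].
Qed.

Section weighted_means.
Context {R : realType} {X : normedModType R[i]}.

Local Notation psum := (resolvent idfun).

Lemma ge0_le_natr (z : R[i]) : 0 <= z -> exists m : nat, z <= m%:R.
Proof.
move=> z0; exists (Num.truncn (complex.Re z)).+1.
rewrite -(RRe_real (ger0_real z0)) -(rmorph_nat (real_complex R)) lecR.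
by rewrite ltW// truncnS_gt.
Qed.

(* Stolz-Cesaro for the weights [C(n + l, l)], whose sums are
   [C(n + l + 1, l + 1)]. *)
Lemma psum_mean_cvg l (f : nat -> X) (v : X) :
  ('C(n + l, l)%:R)^-1 *: f n @[n --> \oo] --> v ->
  ('C(n + l.+1, l.+1)%:R)^-1 *: psum f n @[n --> \oo] --> v.
Proof.
have b0 k m : (0 : R[i]) < 'C(m + k, k)%:R by rewrite ltr0n bin_gt0 leq_addl.
have normE k m (g : nat -> X) : `|v - ('C(m + k, k)%:R)^-1 *: g m| =
    'C(m + k, k)%:R^-1 * `|v *+ 'C(m + k, k) - g m|.
  rewrite -[X in X * _]ger0_norm ?invr_ge0 ?ltW// -normrZ scalerBr.
  by rewrite -[v *+ _]scaler_nat scalerA mulVf ?scale1r// gt_eqF.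
move=> fv; apply/cvgrPdist_le => e e0.
have e20 : 0 < e / 2 by rewrite divr_gt0.
have [n0 _ fe] := (cvgrPdist_le _ _).1 fv _ e20.
set K := `|v *+ 'C(n0 + l.+1, l.+1) - psum f n0|.
(* Beyond [n0] each new term adds at most e/2 times its weight to the unnormalised error [K]. *)
have le m : `|v *+ 'C(n0 + m + l.+1, l.+1) - psum f (n0 + m)| <=
    K + e / 2 * 'C(n0 + m + l.+1, l.+1)%:R.
  elim: m => [|m ih]; first by rewrite addn0 lerDl mulr_ge0 ?ltW.
  rewrite (addnS n0 m) binD_succ mulrnDr natrD mulrDr /= opprD addrACA.
  rewrite [leRHS]addrCA.
  apply: le_trans (ler_normD _ _) _; apply: lerD => //.
  have := fe (n0 + m).+1 (leq_trans (leq_addr _ _) (leqnSn _)).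
  by rewrite /= normE mulrC ler_pdivrMr.
(* Since C(n + l + 1, l + 1) >= n, from [n0 + m0] on the total weight times e/2 exceeds [K]. *)
have [m0 Km] := ge0_le_natr _ (divr_ge0 (normr_ge0 _ : 0 <= K) (ltW e20)).
exists (n0 + m0)%N => // n /= nm.
rewrite normE mulrC ler_pdivrMr//.
have n0n : (n0 <= n)%N := leq_trans (leq_addr _ _) nm.
have := le (n - n0)%N; rewrite subnKC// => /le_trans; apply.
rewrite [leRHS](_ : _ = (e / 2 + e / 2) * 'C(n + l.+1, l.+1)%:R); last first.
  by rewrite -splitr.
rewrite mulrDl lerD2r.
rewrite mulrC -ler_pdivrMr//; apply: le_trans Km _; rewrite ler_nat.
apply: leq_trans (leq_trans (leq_addl _ _) nm) _.
elim: {nm n0n} n => // n ih; rewrite binD_succ -add1n leq_add//.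
by rewrite bin_gt0 leq_addl.
Qed.

Lemma iter_psum_mean_cvg a l (f : nat -> X) (v : X) :
  ('C(n + l, l)%:R)^-1 *: f n @[n --> \oo] --> v ->
  ('C(n + (l + a), l + a)%:R)^-1 *: iter a psum f n @[n --> \oo] --> v.
Proof.
elim: a l f => [|a ih] l f fv; first by rewrite addn0.
by rewrite addnS -addSn iterSr; apply: ih; exact: psum_mean_cvg.
Qed.

(** For k > 0, Phi S = S - R gives a difference of two means with the same normalisation and the
    same limit, so it tends to 0. *)
Lemma iter_subdiag_mean_cvg (T : {linear X -> X}) (y v : X) k a l :
    iter n T y @[n --> \oo] --> v -> (k <= a)%N ->
  ('C(n + (l + a), l + a)%:R)^-1 *: iter k (subdiag T) (iter a psum
    (iter l (resolvent T) (fun m => iter m T y))) n @[n --> \oo]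
  --> (k == 0)%:R *: v.
Proof.
move=> yv; elim: k a l => [|k ih] a l ka.
  rewrite scale1r; apply: iter_psum_mean_cvg.
  under eq_fun do rewrite iter_resolvent_orbit -scaler_nat scalerK
    ?pnatr_eq0 -?lt0n ?bin_gt0 ?leq_addl//.
  exact: yv.
case: a ka => // a ka; under eq_fun do rewrite iter_subdiag_psum fctE scalerBr.
rewrite scale0r -(subrr ((k == 0)%:R *: v)).
apply: cvgB; first by apply: ih; exact: leqW.
by rewrite addnS -addSn -iterS; exact: ih.
Qed.

End weighted_means.

(** * Operator norms and strong limits *)

Section operator_norm.
Context {R : realType} {X : normedModType R[i]}.
Implicit Types S : X -> X.

Lemma opnorm_leP S (c : R) :
  (opnorm S <= c%:E)%E <-> forall x, `|x| <= 1 -> `|S x| <= c%:C.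
Proof.
have normE (v : X) : `|v| = (complex.Re `|v|)%:C by rewrite RRe_real.
split=> [Sc x x1|Sc].
  rewrite normE lecR -lee_fin; apply: le_trans Sc.
  by apply: ereal_sup_ubound; exists x.
apply: ge_ereal_sup => _ [x /= x1 <-].
by rewrite lee_fin -lecR -normE Sc.
Qed.

Lemma power_boundedP S : S 0 = 0 ->
  power_bounded S <-> exists2 M : R, 0 <= M &
    forall n x, `|x| <= 1 -> `|iter n S x| <= M%:C.
Proof.
move=> S0; split=> [|[M M0 SM]].
  rewrite /power_bounded; set s := ereal_sup _ => soo.
  have le n : (opnorm (iter n S) <= s)%E.
    by apply: ereal_sup_ubound; exists n.
  (* Nonnegativity, seen at n = 0 and x = 0, together with [soo] makes the supremum finite. *)
  have s0 : (0 <= s)%E.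
    apply: le_trans (le 0); apply: ereal_sup_ubound; exists 0.
      by rewrite /= normr0 ler01.
    by rewrite /= normr0.
  have sE : s = (fine s)%:E by rewrite fineK// ge0_fin_numE.
  exists (fine s); first exact: fine_ge0.
  by move=> n; apply/opnorm_leP; rewrite -sE.
rewrite /power_bounded; apply: (@le_lt_trans _ _ M%:E); last exact: ltry.
by apply: ge_ereal_sup => _ [n _ <-]; apply/opnorm_leP; exact: SM.
Qed.

Lemma sot_cvgI (F : nat -> X -> X) (L : X -> X) : linear L -> continuous L ->
  (forall x, F n x @[n --> \oo] --> L x) -> sot_cvg F.
Proof.
move=> lL cL FL.
pose L' : {linear X -> X} := HB.pack L (GRing.isLinear.Build _ _ _ _ L lL).
by exists L'.
Qed.

End operator_norm.

(** * Comparison of the binomial weights with powers of n *)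

Lemma expn_le_bin n N : (n ^ N <= 'C(n + N, N) * N`!)%N.
Proof.
rewrite bin_ffact; elim: N => [|N ih]; first by rewrite ffactn0.
rewrite expnS addnS ffactSS mulnC [leqRHS]mulnC leq_mul//.
by rewrite -addnS leq_addr.
Qed.

Lemma bin_le_expn n N : (0 < n)%N -> ('C(n + N, N) <= (2 * n) ^ N)%N.
Proof.
move=> n0; elim: N => [|N ih]; first by rewrite bin0.
rewrite -(leq_pmul2l (ltn0Sn N)) addnS -[leqLHS](mul_bin_diag (n + N).+1 N).
rewrite /= expnS mulnA leq_mul//.
by rewrite -addnS mulnCA mul2n -addnn leq_add ?leq_pmull ?leq_pmulr.
Qed.

(** * Bounds and limits for the block Cesaro sums, and their inversion *)

Section bidiag_cesaro_estimates.
Context {R : realType} {X : normedModType R[i]} (T : {linear X -> X}).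
Context (N : nat).
Implicit Types (x : l2sum X N.+2) (y : X).

Local Notation cesaro := (cesaro_sum (N.+1%:R : R) (bidiag T N.+2)).
Local Notation coord x i := (fun n => cesaro n x (inord i)).

(** The extra Phi^k makes the induction on i work, as Y_(i+1) contains Phi Y_i; k + i <= N + 1
    leaves an S for every Phi. Unfolding gives i + 1 terms, each with constant 2 ^ (N+1). *)
Lemma norm_cesaro_coord_le x (M : R[i]) i k n : 0 <= M ->
    (forall j m, `|iter m T (x j)| <= M) -> (k + i <= N.+1)%N ->
  `|iter k (subdiag T) (coord x i) n|
    <= M *+ (2 ^ N.+1 * i.+1) *+ 'C(n + N.+1, N.+1).
Proof.
move=> M0 xM; have one j l m : (l <= N.+1)%N ->
    `|iter l (subdiag T) (iter N.+1 (resolvent idfun)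
      (fun n => iter n T (x j))) m| <= M *+ 2 ^ N.+1 *+ 'C(m + N.+1, N.+1).
  move=> lN.
  apply: le_trans (norm_iter_subdiag_le T (x j) M _ _ 0 m M0 (xM j) lN) _.
  by rewrite lerMn2r ler_wpMn2l ?orbT// leq_exp2l.
elim: i k => [|i ih] k ki.
  by rewrite cesaro_bidiag_coord0 muln1; apply: one; rewrite addn0 in ki.
rewrite cesaro_bidiag_coordS; last exact: leq_trans (leq_addl _ _) ki.
rewrite iter_subdiagD fctE -iterSr.
apply: le_trans (ler_normD _ _) _.
rewrite mulnS mulrnDr mulrnDl; apply: lerD.
  by apply: one; exact: leq_trans (leq_addr _ _) ki.
by apply: ih; rewrite addSnnS.
Qed.

Lemma norm_cesaro_bidiag_le x (M : R[i]) n : 0 <= M ->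
    (forall j m, `|iter m T (x j)| <= M) ->
  `|cesaro n x| <= M *+ (2 ^ N.+1 * N.+2 ^ 2) *+ 'C(n + N.+1, N.+1).
Proof.
move=> M0 xM; apply: le_trans (l2sum_norm_le_sum _) _.
apply: (@le_trans _ _
  (\sum_(i < N.+2) M *+ (2 ^ N.+1 * N.+2) *+ 'C(n + N.+1, N.+1))).
  apply: ler_sum => i _.
  have := norm_cesaro_coord_le x M i 0 n M0 xM; rewrite inord_val => H.
  apply: le_trans (H _) _; first by rewrite add0n -ltnS.
  by rewrite lerMn2r ler_wpMn2l ?orbT// leq_mul.
by rewrite sumr_const card_ord mulrnAC -[X in X *+ _]mulrnA -mulnA mulnn.
Qed.

Lemma norm_orbit_le y (D : R[i]) n :
    (forall l, `|cesaro n (l2sum_inj0 N y) l| <= D) ->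
  `|iter n T y| *+ 'C(n + N.+1, N.+1) <= D *+ 2 ^ N.+1.
Proof.
move=> yD; rewrite -normrMn orbit_cesaro.
apply: le_trans (ler_norm_sum _ _ _) _.
apply: (@le_trans _ _ (\sum_(l < N.+2) D *+ 'C(N.+1, l))).
  apply: ler_sum => l _.
  by rewrite normrZ normrX normrN1 expr1n mul1r normrMn lerMn2r yD orbT.
rewrite sumrMnr; suff -> : (\sum_(l < N.+2) 'C(N.+1, l) = 2 ^ N.+1)%N by [].
rewrite -[2%N]/(1 + 1)%N expnDn; apply: eq_bigr => l _.
by rewrite !exp1n !muln1.
Qed.

(** Same induction as [norm_cesaro_coord_le]: of the terms in Y_i only the one without Phi keeps a
    nonzero limit. *)
Lemma cesaro_coord_mean_cvg x (v : 'I_N.+2 -> X) i k :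
    (forall j, iter n T (x j) @[n --> \oo] --> v j) -> (k + i <= N.+1)%N ->
  ('C(n + N.+1, N.+1)%:R)^-1 *: iter k (subdiag T) (coord x i) n @[n --> \oo]
  --> (k == 0)%:R *: v (inord i).
Proof.
move=> xv; have one j l : (l <= N.+1)%N ->
    ('C(n + N.+1, N.+1)%:R)^-1 *: iter l (subdiag T) (iter N.+1
      (resolvent idfun) (fun n => iter n T (x j))) n @[n --> \oo]
    --> (l == 0)%:R *: v j.
  exact: iter_subdiag_mean_cvg T (x j) (v j) l N.+1 0 (xv j).
elim: i k => [|i ih] k ki.
  rewrite cesaro_bidiag_coord0.
  have -> : inord 0 = ord0 :> 'I_N.+2 by apply/val_inj; rewrite /= inordK.
  by apply: one; rewrite addn0 in ki.
rewrite cesaro_bidiag_coordS; last exact: leq_trans (leq_addl _ _) ki.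
rewrite iter_subdiagD -iterSr -[X in _ --> X]addr0.
under eq_fun do rewrite fctE scalerDr.
apply: cvgD; first by apply: one; exact: leq_trans (leq_addr _ _) ki.
have := ih k.+1; rewrite scale0r; apply.
by rewrite addSnnS.
Qed.

Lemma bin_expr_cvg :
  (n%:R ^+ N.+1)^-1 * 'C(n + N.+1, N.+1)%:R @[n --> \oo]
  --> ((N.+1`!%:R)^-1 : (R[i] : numFieldType)).
Proof. exact: (bin_power_cvg _ ge0_le_natr). Qed.

Lemma cesaro_coord_cvg x (v : 'I_N.+2 -> X) (i : 'I_N.+2) :
    (forall j, iter n T (x j) @[n --> \oo] --> v j) ->
  (n%:R ^+ N.+1)^-1 *: cesaro n x i @[n --> \oo] --> (N.+1`!%:R)^-1 *: v i.
Proof.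
move=> xv; have := cesaro_coord_mean_cvg x v i 0 xv.
rewrite add0n inord_val scale1r => /(_ (ltn_ord i)) xi.
have zi := cvgZ bin_expr_cvg xi; apply: (cvg_trans _ (zi _)).
apply: near_eq_cvg.
near=> n => /=.
by rewrite scalerA mulfK// pnatr_eq0 -lt0n bin_gt0 leq_addl.
Unshelve. all: by end_near. Qed.

Lemma orbit_cvg y (z : l2sum X N.+2) :
  (n%:R ^+ N.+1)^-1 *: cesaro n (l2sum_inj0 N y) @[n --> \oo] --> z ->
  iter n T y @[n --> \oo] -->
    N.+1`!%:R *: \sum_(l < N.+2) (-1) ^+ l *: (z l *+ 'C(N.+1, l)).
Proof.
move=> yz; have zl := (l2sum_cvgP _ _).1 yz.
have s : \sum_(l < N.+2) (-1) ^+ l *: (((n%:R ^+ N.+1)^-1 *: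
    cesaro n (l2sum_inj0 N y)) l *+ 'C(N.+1, l)) @[n --> \oo] -->
    \sum_(l < N.+2) (-1) ^+ l *: (z l *+ 'C(N.+1, l)).
  apply: cvg_sum_ord => l; apply: cvgZl_tmp; apply: cvgMn; exact: zl.
(* Dividing [orbit_cesaro] by the binomial instead of n ^ (N+1) produces the factor (N+1)!. *)
have b := cvgV _ bin_expr_cvg; rewrite invrK in b.
have N0 : (N.+1`!%:R)^-1 != 0 :> R[i].
  by rewrite invr_eq0 pnatr_eq0 -lt0n fact_gt0.
have c := cvgZ (b _ N0) s.
apply: (cvg_trans _ (c _ _)); apply: near_eq_cvg; exists 1 => // n /= n0.
rewrite (eq_bigr (fun l : 'I_N.+2 => (n%:R ^+ N.+1)^-1 *: ((-1) ^+ l *: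
    (cesaro n (l2sum_inj0 N y) l *+ 'C(N.+1, l))))); last first.
  by move=> l _; rewrite ffunE scalerMnr !scalerA [in LHS]mulrC.
rewrite -scaler_sumr -orbit_cesaro -[iter n T y *+ _]scaler_nat !scalerA.
rewrite -mulrA mulVf ?scale1r// mulf_neq0//.
  by rewrite invr_eq0 expf_neq0// pnatr_eq0 -lt0n.
by rewrite pnatr_eq0 -lt0n bin_gt0 leq_addl.
Qed.

End bidiag_cesaro_estimates.

(** * The equivalences for power boundedness and for strong convergence *)

Lemma power_bounded_cesaro_bidiag {R : realType} {X : normedModType R[i]}
    (T : {linear X -> X}) (N : nat) :
  power_bounded T <-> cesaro_bounded (N.+1%:R : R) (bidiag T N.+2).
Proof.
rewrite power_boundedP ?linear0//; split=> [[M M0 TM]|[c c0 Tc]].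
(* [M + 1] makes the constant positive; the last factor comes from C(n+N+1, N+1) <= (2n) ^ (N+1). *)
- exists ((M + 1) *+ (2 ^ N.+1 * N.+2 ^ 2) * 2 ^+ N.+1).
    by rewrite mulr_gt0 ?exprn_gt0// pmulrn_lgt0 ?ltr_wpDl// muln_gt0 !expn_gt0.
  move=> n n1; apply/opnorm_leP => x x1.
  have M10 : 0 <= M + 1 by rewrite addr_ge0.
  apply: le_trans (norm_cesaro_bidiag_le T N x (M + 1)%:C n _ _) _.
  - by rewrite ler0c.
  - move=> j m; apply: le_trans (TM _ _ (le_trans (l2sum_coord_le _ _) x1)) _.
    by rewrite lecR lerDl.
  rewrite -!rmorphMn lecR powR_mulrn// -mulrA -exprMn -natrM -natrX.
  rewrite -[leLHS]mulr_natr ler_wpM2l//; first by rewrite mulrn_wge0.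
  by rewrite ler_nat bin_le_expn.
(* The summand 1 covers n = 0, about which Cesaro boundedness says nothing; the factorial comes from
   [expn_le_bin]. *)
- exists (c *+ 2 ^ N.+1 *+ N.+1`! + 1).
    by rewrite addr_ge0// !mulrn_wge0// ltW.
  have c20 : 0 <= c *+ 2 ^ N.+1 *+ N.+1`! by rewrite !mulrn_wge0// ltW.
  case=> [|n] y y1.
    by apply: le_trans y1 _; rewrite (_ : 1 = 1%:C)// lecR lerDr.
  have /opnorm_leP Tn := Tc n.+1 isT.
  have iy := le_trans (norm_l2sum_inj0 N y) y1.
  have := norm_orbit_le T N y (c * n.+1%:R `^ N.+1%:R)%:C n.+1
    (fun l => le_trans (l2sum_coord_le _ _) (Tn _ iy)).
  rewrite powR_mulrn// => H.
  have p0 : (0 < n.+1 ^ N.+1)%N by rewrite expn_gt0.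
  rewrite -(ler_pMn2r p0).
  apply: (@le_trans _ _ (`|iter n.+1 T y| *+ ('C(n.+1 + N.+1, N.+1) * N.+1`!))).
    by rewrite ler_wpMn2l// expn_le_bin.
  rewrite mulrnA; apply: (@le_trans _ _
    ((c * n.+1%:R ^+ N.+1)%:C *+ 2 ^ N.+1 *+ N.+1`!)).
    by rewrite lerMn2r H orbT.
  rewrite -!rmorphMn lecR -natrX mulr_natr mulrnAC [X in X *+ _]mulrnAC mulrnAC.
  by rewrite [c *+ _ *+ _]mulrnAC lerMn2r lerDl ler01 orbT.
Qed.

Lemma sot_cvg_cesaro_bidiag {R : realType} {X : normedModType R[i]}
    (T : {linear X -> X}) (N : nat) :
  sot_cvg (fun n => iter n T) <-> sot_cvg (fun n x =>
    ((n%:R : R[i]) ^+ N.+1)^-1 *: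
      cesaro_sum (N.+1%:R : R) (bidiag T N.+2) n x).
Proof.
split=> [[P [cP TP]]|[L [cL TL]]].
(* The limit is block diagonal: [P] in every block, divided by (N+1)!. *)
- apply: (@sot_cvgI R (l2sum X N.+2) _
    (fun x => [ffun i => (N.+1`!%:R)^-1 *: P (x i)] : l2sum X N.+2)).
  + move=> a u v; apply/ffunP => i; rewrite !ffunE linearP scalerDr.
    by rewrite !scalerA mulrC.
  + move=> x; apply/(@l2sum_cvgP _ _ _ _ _ (nbhs_filter x)) => i; rewrite ffunE.
    under eq_fun do rewrite ffunE.
    have idx : id @ nbhs x --> x by exact: cvg_id.
    have xi : (fun y : l2sum X N.+2 => y i) y @[y --> x] --> x i.
      exact: (l2sum_cvgP id x).1 idx i.
    apply: cvgZl_tmp.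
    by apply: (cvg_comp (fun y : l2sum X N.+2 => y i) _ xi); exact: cP.
  + move=> x; apply/l2sum_cvgP => i; rewrite ffunE.
    under eq_fun do rewrite ffunE.
    exact: (cesaro_coord_cvg T N x (fun j => P (x j)) i (fun j => TP (x j))).
- apply: (@sot_cvgI R X _ (fun y => N.+1`!%:R *: \sum_(l < N.+2)
    (-1) ^+ l *: (L (l2sum_inj0 N y) l *+ 'C(N.+1, l)))).
  + move=> a u v; rewrite scalerA [a * _]mulrC -scalerA -scalerDr.
    congr (_ *: _); rewrite scaler_sumr -big_split; apply: eq_bigr => l _ /=.
    rewrite l2sum_inj0_is_linear linearP !ffunE mulrnDl scalerDr scalerMnr.
    by rewrite !scalerA mulrC.
  + move=> y; apply: cvgZl_tmp; apply: cvg_sum_ord => l; apply: cvgZl_tmp.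
    apply: cvgMn.
    have cy : L (l2sum_inj0 N t) @[t --> y] --> L (l2sum_inj0 N y).
      have iy : l2sum_inj0 N t @[t --> y] --> l2sum_inj0 N y; last first.
        by apply: (cvg_comp (l2sum_inj0 N) L iy); exact: cL.
      apply/(@l2sum_cvgP _ _ _ _ _ (nbhs_filter y)) => i; rewrite ffunE.
      under eq_fun do rewrite ffunE.
      by case: ifP => _; [exact: cvg_id|exact: cvg_cst].
    exact: (l2sum_cvgP _ _).1 cy l.
  + by move=> y; exact: orbit_cvg (TL _).
Qed.

Theorem proposition6p1 (R : realType) (X : completeNormedModType R[i])
    (T : {linear X -> X}) (T_cont : continuous T)
    (N : nat) (N_ge1 : (1 <= N)%N) :
  let TN : l2sum X N.+1 -> l2sum X N.+1 := bidiag T N.+1 in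
  (power_bounded T <-> cesaro_bounded (N%:R : R) TN) /\
  (sot_cvg (fun n => iter n T) <->
   sot_cvg (fun n x =>
     ((n%:R : R[i]) ^+ N)^-1 *: cesaro_sum (N%:R : R) TN n x)).
Proof.
case: N N_ge1 => // N _ TN; split.
  exact: power_bounded_cesaro_bidiag.
exact: sot_cvg_cesaro_bidiag.
Qed.
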